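(* Let $k\ge2$, and let $\Omega$ be a strongly convex domain with $C^k$ boundary in the complement of $\mathcal{D}^k$, such that there exists $s_0\in\mathbb{T}$ with $\tau(s_0,0)\mathcal{K}(s_0)>-1$. Then, for $\lambda\in(0,1)$ sufficiently small, the Birkhoff attractor $\Lambda_\lambda$ of the dissipative billiard map $f_\lambda$ within $\Omega$ with constant dissipation $\lambda$ is not a graph over $\mathbb{T}\times\{0\}$.
   Context: Billiard map: $\mathbb{T}=\mathbb{R}/\mathbb{Z}$, $\mathbb{A}=\mathbb{T}\times[-1,1]$ with coordinates $(s,r)$. Let $\Omega\subset\mathbb{R}^2$ be a strictly convex domain with $C^k$ boundary, $k\ge2$, with perimeter normalized to $1$, and let $\Upsilon\colon\mathbb{T}\to\mathbb{R}^2$ be an arclength parametrization of $\partial\Omega$. A pair $(s,r)\in\mathbb{A}$ represents the point $\Upsilon(s)$ together with a unit vector $v$ at $\Upsilon(s)$, pointing inward or tangent to $\partial\Omega$, where $r=\sin\varphi$ and $\varphi\in[-\frac\pi2,\frac\pi2]$ is the oriented angle from $v$ to the inward normal at $\Upsilon(s)$. The conservative billiard map is $f=f_1\colon\mathbb{A}\to\mathbb{A}$, $(s,r)\mapsto(s',r_1')$, where $\Upsilon(s')$ is the next point at which the half-line from $\Upsilon(s)$ in direction $v$ hits $\partial\Omega$ and $r_1'$ is the sine of the reflected angle at $\Upsilon(s')$ for the standard reflection law ($f$ is the identity on $\mathbb{T}\times\{\pm1\}$). For a constant $\lambda\in(0,1)$, the dissipative billiard map with constant dissipation $\lambda$ is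 $f_\lambda(s,r)=(s',\lambda r_1')$. Strongly convex means strictly convex with nowhere vanishing curvature. $\tau(s,r)$ is the length of the first orbit segment of the billiard map starting at $(s,r)$, and $\mathcal{K}(s)<0$ is the curvature of $\partial\Omega$ at $\Upsilon(s)$ (with negative sign convention). $\mathcal{D}^k$ is the set of strongly convex domains with $C^k$ boundary such that $\max_{s\in\mathbb{T}}\tau(s,0)\mathcal{K}(s)<-1$. Attractors: $\Lambda^0_\lambda:=\bigcap_{k\ge0}f_\lambda^k(\mathbb{A})$. The set $\mathbb{A}\setminus\Lambda_\lambda^0$ is the disjoint union of two connected open sets $U_\lambda\supset\mathbb{T}\times\{-1\}$ and $V_\lambda\supset\mathbb{T}\times\{1\}$; the Birkhoff attractor is $\Lambda_\lambda:=\overline{U_\lambda}\cap\overline{V_\lambda}$. *)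

(* Defs.v *)
From mathcomp Require Import all_boot all_order all_algebra.
From mathcomp Require Import generic_quotient.
From mathcomp Require Import all_classical all_reals all_analysis.

Set Implicit Arguments.
Unset Strict Implicit.
Unset Printing Implicit Defensive.

Import Order.TTheory GRing.Theory Num.Theory.
Import numFieldNormedType.Exports.

Local Open Scope ring_scope.
Local Open Scope classical_set_scope.

Definition eq_mod1 (R : realType) : rel R := fun x y => x - y \is a Num.int.

Lemma eq_mod1_refl (R : realType) : reflexive (@eq_mod1 R).
Proof. by move=> x; rewrite /eq_mod1 subrr rpred0. Qed.

Lemma eq_mod1_sym (R : realType) : symmetric (@eq_mod1 R).
Proof. by move=> x y; rewrite /eq_mod1 -rpredN opprB. Qed.

Lemma eq_mod1_trans (R : realType) : transitive (@eq_mod1 R).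
Proof.
by move=> y x z xy yz; rewrite /eq_mod1 -[x](subrK y) -addrA rpredD.
Qed.

Canonical eq_mod1_equiv (R : realType) :=
  EquivRel (@eq_mod1 R) (@eq_mod1_refl R) (@eq_mod1_sym R) (@eq_mod1_trans R).

Definition circle (R : realType) : topologicalType :=
  quotient_topology {eq_quot eq_mod1_equiv R}%qT.

Definition to_circle (R : realType) (x : R) : circle R :=
  (\pi_{eq_quot eq_mod1_equiv R} x)%qT.

Definition lift_circle (R : realType) (s : circle R) : R :=
  repr (s : {eq_quot eq_mod1_equiv R}%qT).

(* The norm carried by 'rV[R]_2 in the library is the sup norm, hence the
   Euclidean structure below. *)
Definition dot (R : realType) (u v : 'rV[R]_2) : R :=
  \sum_(i < 2) u 0 i * v 0 i.

Definition enorm (R : realType) (u : 'rV[R]_2) : R := Num.sqrt (dot u u).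

(* Rotation by - pi / 2. *)
Definition rotN (R : realType) (u : 'rV[R]_2) : 'rV[R]_2 :=
  \row_(i < 2) (if i == 0 then u 0 1 else - u 0 0).

(* Sine of the oriented angle from u to v, for unit vectors u and v. *)
Definition sin_angle (R : realType) (u v : 'rV[R]_2) : R :=
  u 0 0 * v 0 1 - u 0 1 * v 0 0.

Definition frontier (T : topologicalType) (A : set T) : set T :=
  closure A `\` interior A.

Definition strictly_convex (R : realType) (Omega : set 'rV[R]_2) : Prop :=
  forall (x y : 'rV[R]_2) (t : R), closure Omega x -> closure Omega y ->
    x != y -> 0 < t < 1 -> interior Omega ((1 - t) *: x + t *: y).

Definition class_C (R : realType) (V : normedModType R) (k : nat) (f : R -> V)
  : Prop :=
  (forall j x, (j < k)%N -> derivable (f^`(j)) x 1) /\ continuous (f^`(k)).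

(* The j-th derivative of the 1-periodic lift of Ups, which does not depend on
   the representative of s. *)
Definition circle_derive (R : realType) (V : normedModType R) (j : nat)
    (Ups : circle R -> V) (s : circle R) : V :=
  derive1n j (Ups \o @to_circle R) (lift_circle s).

(* Omega is a strictly convex domain with C^k boundary of perimeter 1 and
   Ups : R / Z -> R^2 is an arclength parametrization of its boundary, of
   arbitrary orientation. A boundary is C^k iff its arclength parametrizations
   are. *)
Definition Ck_convex_domain (R : realType) (k : nat) (Omega : set 'rV[R]_2)
    (Ups : circle R -> 'rV[R]_2) : Prop :=
  [/\ open Omega, strictly_convex Omega, class_C k (Ups \o @to_circle R),
      (forall s, enorm (circle_derive 1 Ups s) = 1) &
      injective Ups /\ range Ups = frontier Omega].

Definition curvature (R : realType) (Ups : circle R -> 'rV[R]_2) (s : circle R)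
  : R := - enorm (circle_derive 2 Ups s).

Definition strongly_convex_domain (R : realType) (k : nat)
    (Omega : set 'rV[R]_2) (Ups : circle R -> 'rV[R]_2) : Prop :=
  Ck_convex_domain k Omega Ups /\ forall s, curvature Ups s != 0.

Definition inward_normal (R : realType) (Omega : set 'rV[R]_2)
    (Ups : circle R -> 'rV[R]_2) (s : circle R) : 'rV[R]_2 :=
  xget 0 [set n | [/\ enorm n = 1,
    dot n (circle_derive 1 Ups s) = 0 &
    \forall t \near (0 : R)^'+, Omega (Ups s + t *: n)]].

(* The unit vector v at Ups s with <v, n> >= 0 and sin_angle v n = r, where n
   is the inward normal. *)
Definition direction (R : realType) (Omega : set 'rV[R]_2)
    (Ups : circle R -> 'rV[R]_2) (p : circle R * R) : 'rV[R]_2 :=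
  let n := inward_normal Omega Ups p.1 in
  Num.sqrt (1 - p.2 ^+ 2) *: n + p.2 *: rotN n.

(* tau is the first positive time at which the unit speed half-line hits the
   boundary, which is the length of the first orbit segment. A tangent
   half-line never does: then tau is inf set0 = 0. *)
Definition tau (R : realType) (Omega : set 'rV[R]_2)
    (Ups : circle R -> 'rV[R]_2) (p : circle R * R) : R :=
  inf [set t | 0 < t /\
               frontier Omega (Ups p.1 + t *: direction Omega Ups p)].

Definition next_point (R : realType) (Omega : set 'rV[R]_2)
    (Ups : circle R -> 'rV[R]_2) (p : circle R * R) : circle R :=
  xget p.1 [set s' |
    Ups s' = Ups p.1 + tau Omega Ups p *: direction Omega Ups p].

Definition reflect (R : realType) (n v : 'rV[R]_2) : 'rV[R]_2 :=
  v - (2 * dot v n) *: n.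

Definition billiard (R : realType) (Omega : set 'rV[R]_2)
    (Ups : circle R -> 'rV[R]_2) (p : circle R * R) : circle R * R :=
  if `|p.2| < 1 then
    let s' := next_point Omega Ups p in
    let n' := inward_normal Omega Ups s' in
    (s', sin_angle (reflect n' (direction Omega Ups p)) n')
  else p.

Definition dissipative_billiard (R : realType) (Omega : set 'rV[R]_2)
    (Ups : circle R -> 'rV[R]_2) (lambda : R) (p : circle R * R)
  : circle R * R :=
  let q := billiard Omega Ups p in (q.1, lambda * q.2).

Definition class_D (R : realType) (k : nat) (Omega : set 'rV[R]_2)
    (Ups : circle R -> 'rV[R]_2) : Prop :=
  strongly_convex_domain k Omega Ups /\
  exists2 s, (forall s', tau Omega Ups (s', 0) * curvature Ups s' <=
                         tau Omega Ups (s, 0) * curvature Ups s) &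
             tau Omega Ups (s, 0) * curvature Ups s < -1.

Definition annulus (R : realType) : set (circle R * R) :=
  [set p | `|p.2| <= 1].

Definition attractor (R : realType) (Omega : set 'rV[R]_2)
    (Ups : circle R -> 'rV[R]_2) (lambda : R) : set (circle R * R) :=
  \bigcap_k (iter k (dissipative_billiard Omega Ups lambda) @` @annulus R).

(* For e = -1 and e = 1, the piece of annulus `\` attractor that contains the
   boundary circle of height e, as the connected component of one point of
   this circle. See boundary_component_unique. *)
Definition boundary_component (R : realType) (Omega : set 'rV[R]_2)
    (Ups : circle R -> 'rV[R]_2) (lambda e : R) : set (circle R * R) :=
  connected_component (@annulus R `\` attractor Omega Ups lambda)
    (to_circle 0, e).

Lemma boundary_component_unique (R : realType) (Omega : set 'rV[R]_2)
    (Ups : circle R -> 'rV[R]_2) (lambda : R) (U V : set (circle R * R)) :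
  @annulus R `\` attractor Omega Ups lambda = U `|` V -> U `&` V = set0 ->
  connected U -> connected V ->
  (exists2 W, open W & U = @annulus R `&` W) ->
  (exists2 W, open W & V = @annulus R `&` W) ->
  (forall s, U (s, -1)) -> (forall s, V (s, 1)) ->
  boundary_component Omega Ups lambda (-1) = U /\
  boundary_component Omega Ups lambda 1 = V.
Proof.
rewrite /boundary_component => ->.
have main (x : circle R * R) (A B : set (circle R * R)) : A `&` B = set0 ->
    connected A -> (exists2 W, open W & A = @annulus R `&` W) ->
    (exists2 W, open W & B = @annulus R `&` W) -> A x ->
    connected_component (A `|` B) x = A.
  move=> AB0 cA [W oW AW] [Z oZ BZ] Ax.
  have WA y : (A `|` B) y -> W y -> A y.
    by case=> //; rewrite BZ AW => -[].
  have nZA y : (A `|` B) y -> ~ Z y -> A y.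
    by case=> //; rewrite BZ => -[].
  have AnZ y : A y -> ~ Z y.
    move=> Ay Zy; have : (A `&` B) y; last by rewrite AB0.
    by split=> //; rewrite BZ; split=> //; move: Ay; rewrite AW => -[].
  have AsubW : A `<=` W by rewrite AW => y [].
  apply/seteqP; split; last exact: connected_component_max.
  set C := connected_component (A `|` B) x.
  have CAB : C `<=` A `|` B by exact: connected_component_sub.
  suff <- : C `&` A = C by move=> y [].
  apply: (component_connected (A := A `|` B) (x := x)).
  - exists x; split=> //.
    by apply: connected_component_refl; left.
  - exists W => //; apply/seteqP; split=> y [Cy].
      by move=> /AsubW.
    by move=> Wy; split=> //; apply: WA => //; exact: CAB.
  - exists (~` Z); first exact: open_closedC.
    apply/seteqP; split=> y [Cy].
      by move=> /AnZ.
    by move=> nZy; split=> //; apply: nZA => //; exact: CAB.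
move=> UV0 cU cV oU oV Us Vs; split; first exact: main.
by rewrite setUC; apply: main => //; rewrite setIC.
Qed.

Definition birkhoff_attractor (R : realType) (Omega : set 'rV[R]_2)
    (Ups : circle R -> 'rV[R]_2) (lambda : R) : set (circle R * R) :=
  closure (boundary_component Omega Ups lambda (-1)) `&`
  closure (boundary_component Omega Ups lambda 1).

Definition is_graph (R : realType) (A : set (circle R * R)) : Prop :=
  exists eta : circle R -> R, A = [set p | p.2 = eta p.1].

(* Main.v *)
Require Import Defs.
From mathcomp Require Import all_boot all_order all_algebra.
From mathcomp Require Import generic_quotient.
From mathcomp Require Import all_classical all_reals all_analysis.
From mathcomp Require Import zify ring lra.

Set Implicit Arguments.
Unset Strict Implicit.
Unset Printing Implicit Defensive.

Import Order.TTheory GRing.Theory Num.Theory.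
Import numFieldNormedType.Exports.
Local Open Scope ring_scope.
Local Open Scope classical_set_scope.

(** Let [T] be the unit tangent of the boundary, [X] the boundary curve lifted
    to the line, and write the first coordinate of the billiard map on the
    universal cover as [s + arc s r] with [0 <= arc s r <= 1].

    Suppose that the Birkhoff attractor is the graph of [eta]. The dissipative
    map sends the annulus into the strip [`|r| <= lambda], is continuous and
    injective, and moves the boundary circles vertically; this forces
    [`|eta| <= lambda] and the invariance of the graph
    ([birkhoff_graph_invariant]). On an invariant graph the first coordinate of
    an injective map is injective, so the lift [s + arc s (eta s)], which is
    continuous and of degree one, is increasing ([graph_lift_increasing]).

    As [lambda] tends to [0] these lifts tend to [G s = s + arc s 0], the end
    point of the chord issued perpendicularly from [X s]. Differentiating
    [<X (G a) - X s, T s>] at [s = a], with the end point frozen, gives at most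
    [-1 + tau * `|curvature|]. At the point of the hypothesis this is negative,
    hence for some [b > a] the perpendicular chord from [X b] falls short of
    [X (G a)], that is [G b < G a] ([retrograde]). Only the two points [a] and
    [b] matter, so pointwise continuity of [arc] at [r = 0] already contradicts
    monotonicity for small [lambda].

    The work lies in the billiard map itself. By strict convexity the boundary
    is transverse to all its chords ([tangent_transverse]), and two of its
    points are never seen in the same direction from a third one
    ([frontier_ray_unique]). The chord divided by
    [h * (1 - h)] extends to a nowhere vanishing continuous function of [(s, h)]
    up to [h = 0] and [h = 1]; consequently [arc] is the unique solution of a
    closed condition on a compact interval, which makes it continuous up to
    grazing incidence ([arc_continuous]). Injectivity is time reversal
    ([chord_rel_reverse]). *)

(** * The circle and the cylinder *)

Section Circle.
Context {R : realType}.

Lemma to_circleP (x y : R) :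
  to_circle x = to_circle y <-> x - y \is a Num.int.
Proof.
rewrite /to_circle; split => [/eqquotP //|xy].
by apply/eqquotP.
Qed.

Lemma lift_circleK (s : circle R) : to_circle (lift_circle s) = s.
Proof. exact: reprK. Qed.

Lemma lift_to_circle (x : R) : lift_circle (to_circle x) - x \is a Num.int.
Proof. by apply/to_circleP; rewrite lift_circleK. Qed.

Lemma to_circle_continuous : continuous (@to_circle R).
Proof. exact: pi_continuous. Qed.

Lemma to_circleDint (x z : R) : z \is a Num.int ->
  to_circle (x + z) = to_circle x.
Proof. by move=> zint; apply/to_circleP; rewrite addrC addKr. Qed.

Lemma to_circle_open (A : set R) : open A -> open (@to_circle R @` A).
Proof.
move=> oA; rewrite /open /= /quotient_open.
have -> : (\pi_(quotient_topology {eq_quot eq_mod1_equiv R})%qT @^-1`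
    (@to_circle R @` A) = \bigcup_(z in [set z : R | z \is a Num.int])
      ((fun x => x + z) @^-1` A))%R.
  apply/seteqP; split => x /=.
    move=> [y Ay /to_circleP yx]; exists (y - x) => //=.
    by rewrite addrC subrK.
  move=> [z zint Axz]; exists (x + z) => //.
  exact: to_circleDint.
apply: bigcup_open => z _; apply: open_comp => // x _.
by apply: cvgD; [exact: cvg_id|exact: cvg_cst].
Qed.

(** Nearness on the cylinder may be tested on its universal cover. *)
Lemma near_cylinder (s r : R) (P : circle R * R -> Prop) :
  (\forall p \near (s, r), P (to_circle p.1, p.2)) ->
  \forall p \near (to_circle s, r), P p.
Proof.
move=> [[A B] /= [nA nB] AB].
move: nA; rewrite nbhsE /= => -[A' [oA' A's] A'A].
have nA' : nbhs (to_circle s : circle R) (@to_circle R @` A').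
  apply: open_nbhs_nbhs; split; first exact: to_circle_open.
  by exists s.
exists (@to_circle R @` A', B); first by split.
move=> [x y] /= [[z A'z <-] By]; apply: (AB (z, y)); split => //=.
exact: A'A.
Qed.

Lemma continuous_cylinder (T : topologicalType) (f : circle R * R -> T) :
  continuous (fun p : R * R => f (to_circle p.1, p.2)) -> continuous f.
Proof.
move=> cf [s r]; rewrite -(lift_circleK s) => A nA.
apply: (@near_cylinder _ _ (f @^-1` A)); exact: (cf (lift_circle s, r)).
Qed.

End Circle.

(** * Continuity from a closed graph *)

(** Compactness of the codomain forces the values near [x] to cluster, and a
    closed graph allows a single cluster value. *)
Lemma closed_graph_continuous (R : realType) (T : topologicalType)
    (f : T -> R) (a b : R) :
  (forall x, a <= f x <= b) -> closed [set p : T * R | p.2 = f p.1] ->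
  continuous f.
Proof.
move=> fab cG x; apply/cvgrPdist_lt => e e0.
pose K := `[a, b]%classic `\` [set y | `|f x - y| < e].
have cK : compact K.
  apply: (@subclosed_compact _ _ `[a, b]%classic); last first.
  - by move=> y [].
  - exact: segment_compact.
  apply: closedI; first exact: interval_closed.
  apply: open_closedC; rewrite (_ : mkset _ = ball (f x) e) //.
  exact: ball_open.
move/compact_near_coveringP : cK => /(_ _ (nbhs x) (fun z y => y <> f z) _).
have cov y : K y -> \forall y' \near y & z \near x, y' <> f z.
  move=> [_ /= ye].
  have : nbhs (x, y) (~` [set p : T * R | p.2 = f p.1]).
    apply: open_nbhs_nbhs; split; first exact: closed_openC.
    by move=> /= yfx; apply: ye; rewrite yfx subrr normr0.
  move=> [[A B] /= [nA nB] AB]; exists (B, A) => //= -[u v] [/= Bu Av].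
  exact: (AB (v, u)).
move=> /(_ cov); apply: filterS => z zK; rewrite ltNge; apply/negP => ez.
apply: (zK (f z)) => //; split; first by rewrite /= in_itv /= fab.
by rewrite /= ltNge ez.
Qed.

(** * Invariance of the Birkhoff attractor *)

Section Dynamics.
Context {R : realType}.
Implicit Types (p q : circle R * R).
Variables (f : circle R * R -> circle R * R) (lam : R).
Hypothesis lam01 : 0 < lam < 1.
Hypothesis f_le : forall p, annulus p -> `|(f p).2| <= lam.
Hypothesis f_inj : forall p q, annulus p -> annulus q -> f p = f q -> p = q.
Hypothesis f_cont : {within @annulus R, continuous f}.
Hypothesis f_bnd : forall s e, `|e| = 1 -> f (s, e) = (s, lam * e).

Local Notation A := (@annulus R).
Local Notation L0 := (\bigcap_k (iter k f @` A)).
Local Notation comp e := (connected_component (A `\` L0) (to_circle 0, e)).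
Local Notation Lam := (closure (comp (-1)) `&` closure (comp 1)).

Let f_annulus p : A p -> A (f p).
Proof.
move=> Ap; apply: le_trans (f_le Ap) _.
by case/andP: lam01 => _ /ltW.
Qed.

Let iter_annulus k p : A p -> A (iter k f p).
Proof. by move=> Ap; elim: k => [//|k IH]; rewrite iterS; exact: f_annulus. Qed.

Let L0_le p : L0 p -> `|p.2| <= lam.
Proof. by move=> /(_ 1%N I)[q Aq <-]; exact: f_le. Qed.

(** Injectivity is what prevents a point outside the attractor from entering
    it. *)
Let compl_L0_stable p : (A `\` L0) p -> (A `\` L0) (f p).
Proof.
move=> [Ap nL]; split; first exact: f_annulus.
apply: contra_not nL => L0fp k _.
have [q Aq] := L0fp k.+1 I.
rewrite iterS => /f_inj fqp; exists q => //.
by apply: fqp => //; exact: iter_annulus.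
Qed.

(** The attractor lies in the strip of height [lam], so a slanted segment joins
    any point beyond it to the base point of the boundary circle. Points at
    height exactly [lam] are reached too, as long as they are off the
    attractor: this covers the image of the boundary circle. *)
Let comp_collar e p : `|e| = 1 -> lam <= e * p.2 -> (A `\` L0) p -> comp e p.
Proof.
move=> e1 p2l nLp; have [lam0 lam1] := andP lam01.
have Ap : `|p.2| <= 1 by case: nLp.
pose g (t : R) : circle R * R :=
  (to_circle (t * lift_circle p.1), (1 - t) * e + t * p.2).
have e2 : e * e = 1 by rewrite -expr2 -real_normK ?num_real// e1 expr1n.
have cg : continuous g.
  move=> t.
  apply: (@cvg_pair _ _ _ (nbhs t) (nbhs (g t).1) (nbhs (g t).2)) => /=.
    apply: (cvg_comp (fun t => t * lift_circle p.1) (@to_circle R)).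
      by apply: cvgM; [exact: cvg_id|exact: cvg_cst].
    exact: to_circle_continuous.
  apply: cvgD; apply: cvgM; [|exact: cvg_cst|exact: cvg_id|exact: cvg_cst].
  by apply: cvgB; [exact: cvg_cst|exact: cvg_id].
have g0 : g 0 = (to_circle 0, e) by rewrite /g mul0r subr0 mul1r mul0r addr0.
have g1 : g 1 = p.
  by rewrite /g mul1r lift_circleK subrr mul0r mul1r add0r; case: (p).
suff : g @` `[0, 1]%classic `<=` comp e.
  by apply; exists 1 => //=; rewrite in_itv /= ler01 lexx.
apply: connected_component_max.
- by exists 0 => //=; rewrite in_itv /= ler01 lexx.
- move=> _ [t /= + <-]; rewrite in_itv /= => /andP[t0 t1].
  have [->|tn1] := eqVneq t 1; first by rewrite g1.
  have t1' : t < 1 by rewrite lt_neqAle tn1.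
  have p21 : e * p.2 <= 1.
    by rewrite (le_trans (ler_norm _))// normrM e1 mul1r.
  have gE : e * (g t).2 = (1 - t) + t * (e * p.2).
    by rewrite /= mulrDr mulrCA e2 mulr1 mulrCA.
  have g2l : lam < e * (g t).2 by rewrite gE; nra.
  have g21 : e * (g t).2 <= 1 by rewrite gE; nra.
  have gabs : `|(g t).2| = e * (g t).2.
    by rewrite -(ger0_norm (ltW (lt_trans lam0 g2l))) normrM e1 mul1r.
  split; first by rewrite /annulus /= gabs.
  by move=> /L0_le; rewrite gabs leNgt g2l.
- apply: connected_continuous_connected; first exact: segment_connected.
  exact: continuous_subspaceT.
Qed.

Let boundary_compl e s : `|e| = 1 -> (A `\` L0) (s, e).
Proof.
move=> e1; split; first by rewrite /annulus /= e1.
by move=> /L0_le /=; rewrite e1 leNgt; case/andP: lam01 => _ ->.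
Qed.

Let comp_sub e : comp e `<=` A `\` L0.
Proof. exact: connected_component_sub. Qed.

Let comp_stable e p : `|e| = 1 -> comp e p -> comp e (f p).
Proof.
move=> e1 cp.
have e2 : e * e = 1 by rewrite -expr2 -real_normK ?num_real// e1 expr1n.
have base : comp e (to_circle 0, e).
  by apply: connected_component_refl; exact: boundary_compl.
have fbase : comp e (f (to_circle 0, e)).
  apply: comp_collar => //; last exact/compl_L0_stable/boundary_compl.
  by rewrite f_bnd //= mulrCA e2 mulr1.
have : f @` comp e `<=`
    connected_component (A `\` L0) (f (to_circle 0, e)).
  apply: connected_component_max.
  - by exists (to_circle 0, e).
  - by move=> _ [q /comp_sub qc <-]; exact: compl_L0_stable.
  - apply: connected_continuous_connected; first exact: component_connected.
    apply: continuous_subspaceW f_cont.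
    by move=> q /comp_sub [].
rewrite -(same_connected_component fbase); apply.
by exists p.
Qed.

(** Continuity carries the invariance of the components to their closures. *)
Let Lam_stable p : A p -> Lam p -> Lam (f p).
Proof.
suff H e : `|e| = 1 -> A p -> closure (comp e) p -> closure (comp e) (f p).
  by move=> Ap [cu cv]; split; apply: H => //; rewrite ?normrN normr1.
move=> e1 Ap cp B nB.
have : within A (nbhs p) (f @^-1` B).
  by rewrite (nbhs_subspace_in Ap); exact: f_cont.
move=> /cp[q [cq]].
have [Aq _] := comp_sub cq.
move=> /(_ Aq) Bfq; exists (f q); split => //.
exact: comp_stable.
Qed.

(** A graph meets each fiber once, so the two components differ: otherwise both
    boundary circles would belong to [Lam]. A point of [Lam] outside the strip
    of height [lam] would have a neighborhood inside one component that meets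
    the other. *)
Lemma birkhoff_graph_invariant (eta : circle R -> R) :
  Lam = [set p | p.2 = eta p.1] ->
  (forall s, `|eta s| <= lam) /\
  (forall s, (f (s, eta s)).2 = eta (f (s, eta s)).1).
Proof.
move=> LE; have graph s : Lam (s, eta s) by rewrite LE.
have [lam0 lam1] := andP lam01.
have cbase e : `|e| = 1 -> comp e (to_circle 0, e).
  by move=> e1; apply: connected_component_refl; exact: boundary_compl.
have n11 : `|-1 : R| = 1 by rewrite normrN normr1.
have ndisj : ~ (comp (-1) = comp 1).
  move=> E.
  have : Lam (to_circle 0, 1).
    by split; apply: subset_closure; rewrite ?E; apply: cbase; rewrite normr1.
  have : Lam (to_circle 0, -1).
    by split; apply: subset_closure; rewrite -?E; apply: cbase.
  by rewrite LE /= => <- ; lra.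
have high e s : `|e| = 1 -> closure (comp (- e)) (s, eta s) ->
    lam < e * eta s -> comp (- e) = comp e.
  move=> e1 cl lt.
  have nB : nbhs (s, eta s) [set p : circle R * R | lam < e * p.2].
    apply: open_nbhs_nbhs; split => //.
    apply: (@open_comp _ _ (fun p : circle R * R => e * p.2) [set y | lam < y]).
      move=> q _; apply: cvgM; [exact: cvg_cst|exact: cvg_snd].
    exact: open_gt.
  have [q [cq /= lq]] := cl _ nB.
  have cq' : comp e q.
    by apply: comp_collar => //; [exact: ltW|exact: comp_sub cq].
  rewrite (same_connected_component cq).
  by rewrite -(same_connected_component cq').
have eta_le s : `|eta s| <= lam.
  have [cu cv] := graph s.
  rewrite leNgt; apply/negP => lt; apply: ndisj.
  have [e0|e0] := leP 0 (eta s).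
    apply: (high 1 s) => //; first by rewrite normr1.
    by rewrite mul1r -(ger0_norm e0).
  rewrite -[in RHS](opprK 1); apply/esym/(high (-1) s) => //.
    by rewrite opprK.
  by rewrite mulN1r -(ltr0_norm e0).
split => // s.
have : Lam (f (s, eta s)).
  by apply: Lam_stable => //; rewrite /annulus /=; exact: le_trans (ltW lam1).
by rewrite LE.
Qed.

End Dynamics.

(** * Plane vectors *)

Section Plane.
Context {R : realType}.
Implicit Types (u v w : 'rV[R]_2) (a b : R).

Lemma dotE u v : dot u v = u 0 0 * v 0 0 + u 0 1 * v 0 1.
Proof.
rewrite /dot big_ord_recl big_ord1.
by rewrite (_ : lift ord0 ord0 = 1 :> 'I_2) //; apply: val_inj.
Qed.

Lemma plane_eq u v : u 0 0 = v 0 0 -> u 0 1 = v 0 1 -> u = v.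
Proof.
move=> e0 e1; apply/rowP => -[[|[|//]] i2].
  by rewrite (_ : Ordinal i2 = 0) //; apply: val_inj.
by rewrite (_ : Ordinal i2 = 1) //; apply: val_inj.
Qed.

Lemma dotC u v : dot u v = dot v u.
Proof. by rewrite !dotE; ring. Qed.

Lemma dotZl a u v : dot (a *: u) v = a * dot u v.
Proof. by rewrite !dotE !mxE; ring. Qed.

Lemma dotZr a u v : dot v (a *: u) = a * dot v u.
Proof. by rewrite !dotE !mxE; ring. Qed.

Lemma dot_ge0 u : 0 <= dot u u.
Proof. by rewrite dotE -!expr2 addr_ge0 ?sqr_ge0. Qed.

Lemma enorm_ge0 u : 0 <= enorm u.
Proof. exact: sqrtr_ge0. Qed.

Lemma sqr_enorm u : enorm u ^+ 2 = dot u u.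
Proof. by rewrite /enorm sqr_sqrtr // dot_ge0. Qed.

Lemma enorm_eq0 u : (enorm u == 0) = (u == 0).
Proof.
apply/eqP/eqP => [u0|->]; last first.
  by rewrite /enorm dotE !mxE mul0r addr0 sqrtr0.
have : dot u u = 0 by rewrite -sqr_enorm u0 expr0n.
rewrite dotE => /eqP; rewrite -!expr2 paddr_eq0 ?sqr_ge0 // !sqrf_eq0.
by move=> /andP[/eqP h0 /eqP h1]; apply: plane_eq; rewrite mxE.
Qed.

Lemma enorm1P u : enorm u = 1 <-> dot u u = 1.
Proof.
split => [u1|u1]; first by rewrite -sqr_enorm u1 expr1n.
by rewrite /enorm u1 sqrtr1.
Qed.

(** Lagrange's identity in the plane. *)
Lemma dot_cross_sqr u v :
  dot u v ^+ 2 + sin_angle u v ^+ 2 = dot u u * dot v v.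
Proof. by rewrite !dotE /sin_angle; ring. Qed.

Lemma frame_decomposition u v : dot u u = 1 ->
  v = dot v u *: u - sin_angle u v *: rotN u.
Proof.
rewrite !dotE /sin_angle => u1.
apply: plane_eq; rewrite !mxE /= -[LHS]mulr1 -u1; ring.
Qed.

Lemma dot_le1 u v : dot u u = 1 -> dot v v = 1 -> `|dot u v| <= 1.
Proof.
move=> u1 v1; rewrite -(@expr_le1 _ 2) // real_normK ?num_real //.
by have := dot_cross_sqr u v; rewrite u1 v1 mulr1; nra.
Qed.

Lemma dot_le_enorm u v : dot u v <= enorm u * enorm v.
Proof.
rewrite (le_trans (ler_norm _)) // -(@ler_pXn2r _ 2) ?nnegrE //; last first.
  by rewrite mulr_ge0 ?enorm_ge0.
rewrite real_normK ?num_real // exprMn !sqr_enorm -dot_cross_sqr.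
by rewrite lerDl sqr_ge0.
Qed.

Lemma dot_continuous (S : topologicalType) (f g : S -> 'rV[R]_2) :
  (forall i, continuous (fun x => f x 0 i)) ->
  (forall i, continuous (fun x => g x 0 i)) ->
  continuous (fun x => dot (f x) (g x)).
Proof.
move=> cf cg; have -> : (fun x => dot (f x) (g x)) =
    (fun x => f x 0 0 * g x 0 0 + f x 0 1 * g x 0 1).
  by apply/funext => x; rewrite dotE.
move=> x; apply: cvgD; apply: cvgM.
- exact: cf.
- exact: cg.
- exact: cf.
- exact: cg.
Qed.

Lemma enorm_continuous (S : topologicalType) (f : S -> 'rV[R]_2) :
  (forall i, continuous (fun x => f x 0 i)) ->
  continuous (fun x => enorm (f x)).
Proof.
move=> cf x; apply: (cvg_comp (fun y => dot (f y) (f y)) (@Num.sqrt R)).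
  exact: dot_continuous.
exact: sqrt_continuous.
Qed.

End Plane.

(** * Divided differences *)

Lemma derive_lt0_right (R : realType) (f : R -> R) (x d c : R) :
  is_derive x (1 : R) f d -> d < 0 -> x < c ->
  exists2 b, x < b < c & f b < f x.
Proof.
move=> [+ dE]; rewrite /derivable -dE /derive => df d0 xc.
have [e /= e0 eP] := cvgr_lt _ df _ d0.
pose h := Num.min (e / 2) ((c - x) / 2).
have h0 : 0 < h by rewrite lt_min !divr_gt0 // subr_gt0.
have he : h < e by rewrite (@le_lt_trans _ _ (e / 2)) ?ge_min ?lexx //; lra.
have hc : h <= (c - x) / 2 by rewrite ge_min lexx orbT.
exists (x + h); first by apply/andP; split; lra.
have /(_ h) := eP; rewrite /ball_ /= sub0r normrN gtr0_norm // he gt_eqF //.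
move=> /(_ isT isT); rewrite pmulr_rlt0 ?invr_gt0 // subr_lt0.
by rewrite [_%:A]mulr1 addrC.
Qed.

Section Slope.
Context {R : realType}.
Variables (f df : R -> R).
Hypothesis fdf : forall x : R, is_derive x (1 : R) f (df x).
Hypothesis cdf : continuous df.

Definition slope (s h : R) : R :=
  if h == 0 then df s else (f (s + h) - f s) / h.

Let cf : continuous f.
Proof.
move=> x; apply/differentiable_continuous/derivable1_diffP.
by have [] := fdf x.
Qed.

Let slope_mean s h : exists2 c, `|c - s| <= `|h| & slope s h = df c.
Proof.
rewrite /slope; case: eqVneq => [->|h0]; first by exists s; rewrite ?subrr.
have [h_gt|h_lt|h_eq] := ltgtP 0 h; last by rewrite -h_eq eqxx in h0.
- have [||c] := @MVT _ f df s (s + h) _ (fun x _ => fdf x).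
  + by rewrite ltrDl.
  + exact: continuous_subspaceT.
  + rewrite in_itv /= => /andP[sc ch] ->; exists c.
      by rewrite !gtr0_norm ?subr_gt0 // lerBlDl ltW.
    by rewrite addrC addKr mulfK.
- have [||c] := @MVT _ f df (s + h) s _ (fun x _ => fdf x).
  + by rewrite gtrDl.
  + exact: continuous_subspaceT.
  + rewrite in_itv /= => /andP[sc ch] E; exists c.
      by rewrite !ltr0_norm ?subr_lt0 // opprB; lra.
    rewrite -opprB E (_ : s - (s + h) = - h); last by ring.
    by rewrite mulrN opprK mulfK.
Qed.

(** The divided difference of a C^1 function extends continuously across the
    diagonal, because it is a value of the derivative between the nodes. *)
Lemma slope_continuous : continuous (fun p : R * R => slope p.1 p.2).
Proof.
move=> [s0 h0]; have [->|hn0] := eqVneq h0 0.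
  apply/cvgrPdist_lt => e e0.
  have /cvgrPdist_lt /(_ e e0) := cdf (x := s0).
  move=> /nbhs_ballP[d /= d0 dP].
  have d2 : 0 < d / 2 by rewrite divr_gt0.
  have /cvgrPdist_lt /(_ _ d2) near1 :
    (fun p : R * R => p.1) @ (s0, 0 : R) --> s0 by exact: cvg_fst.
  have /cvgrPdist_lt /(_ _ d2) near2 :
    (fun p : R * R => p.2) @ (s0, 0 : R) --> (0 : R) by exact: cvg_snd.
  near=> p; rewrite {1}/slope eqxx.
  have [c cp ->] := slope_mean p.1 p.2.
  apply: dP; rewrite /ball /= (le_lt_trans (ler_distD p.1 _ _)) //.
  rewrite (splitr d) ltrD //.
    by near: p.
  rewrite distrC (le_lt_trans cp) // -normrN -sub0r.
  by near: p.
have sndh : (fun p : R * R => p.2) @ (s0, h0) --> h0 by exact: cvg_snd.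
have E : {near (s0, h0), (fun p : R * R => (f (p.1 + p.2) - f p.1) / p.2) =1
    (fun p => slope p.1 p.2)}.
  near=> p; rewrite /slope ifN //.
  by near: p; apply: (cvgr_neq0 _ sndh hn0).
apply: cvg_trans (near_eq_cvg E) _.
rewrite /slope /= (negbTE hn0).
apply: cvgM; last by apply: cvgV => //; exact: cvg_snd.
apply: cvgB.
  apply: (cvg_comp (fun p : R * R => p.1 + p.2) f); last exact: cf.
  by apply: cvgD; [exact: cvg_fst|exact: cvg_snd].
apply: (cvg_comp (fun p : R * R => p.1) f); last exact: cf.
exact: cvg_fst.
Unshelve. all: by end_near. Qed.

End Slope.

(** * The boundary of a strictly convex table *)

Section Table.
Context {R : realType}.
Variables (Omega : set 'rV[R]_2) (X T : R -> 'rV[R]_2).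
Hypothesis oO : open Omega.
Hypothesis scO : strictly_convex Omega.
Hypothesis dX : forall s : R, is_derive s (1 : R) X (T s).
Hypothesis cT : forall i, continuous (fun s => T s 0 i).
Hypothesis uT : forall s, dot (T s) (T s) = 1.
Hypothesis Xeq : forall s t, X s = X t <-> s - t \is a Num.int.
Hypothesis XO : range X = frontier Omega.

Lemma frontier_X s : frontier Omega (X s).
Proof. by rewrite -XO; exists s. Qed.

Lemma frontier_notin y : frontier Omega y -> ~ Omega y.
Proof. by move=> [_]; rewrite (iffLR (interior_id _) oO). Qed.

Lemma open_chord (x y : 'rV[R]_2) t :
  frontier Omega x -> closure Omega y -> x != y ->
  0 < t < 1 -> Omega (x + t *: (y - x)).
Proof.
move=> [cx _] cy xy t01; apply: interior_subset.
rewrite (_ : x + _ = (1 - t) *: x + t *: y); first exact: scO.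
by apply: plane_eq; rewrite !mxE; ring.
Qed.

(** The nearer of two such points would lie inside the chord from [p] to the
    farther one. *)
Lemma frontier_ray_unique p v (t1 t2 : R) : v != 0 -> 0 < t1 -> 0 < t2 ->
  frontier Omega p -> frontier Omega (p + t1 *: v) ->
  frontier Omega (p + t2 *: v) -> t1 = t2.
Proof.
move=> v0; wlog t12 : t1 t2 / t1 < t2 => [H t1g t2g fp f1 f2|].
  have [lt|gt|//] := ltgtP t1 t2; first exact: H.
  by apply/esym; exact: H.
move=> t1g t2g fp /frontier_notin f1 [c2 _]; exfalso; apply: f1.
have -> : p + t1 *: v = p + (t1 / t2) *: (p + t2 *: v - p).
  by rewrite addrAC subrr add0r scalerA divfK // gt_eqF.
apply: open_chord => //; last by rewrite divr_gt0 //= ltr_pdivrMr // mul1r.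
by rewrite eq_sym -subr_eq0 addrAC subrr add0r scaler_eq0 negb_or gt_eqF.
Qed.

Lemma cvg_chord s : (fun h : R => h^-1 *: (X (s + h) - X s)) @ 0^' --> T s.
Proof.
have [dXs <-] := dX s.
have /= := dXs; rewrite /derivable /derive => H.
apply: cvg_trans H; apply: near_eq_cvg; near=> h.
rewrite /=; congr (_ *: (X _ - _)).
by rewrite addrC; congr (_ + _); exact: mulr1.
Unshelve. all: by end_near. Qed.

(** If the tangent line met the closure again, a point of the table would lie
    on it, and the boundary arc, being tangent to that line, would enter the
    open cone over a neighborhood of that point. *)
Lemma tangent_transverse s y : closure Omega y -> y != X s ->
  sin_angle (T s) (y - X s) != 0.
Proof.
move=> cy ys; apply/eqP => sa0.
pose c := dot (y - X s) (T s).
have yE : y = X s + c *: T s.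
  rewrite -[y in LHS](subrK (X s)) addrC; congr (_ + _).
  by rewrite {1}(frame_decomposition (y - X s) (uT s)) sa0 scale0r subr0.
have c0 : c != 0.
  by apply: contraNneq ys => c0; rewrite yE c0 scale0r addr0.
have : (fun h : R => X s + (c / 2) *: (h^-1 *: (X (s + h) - X s))) @ 0^' -->
    X s + (c / 2) *: T s.
  apply: cvgD; first exact: cvg_cst.
  by apply: cvgZ; [exact: cvg_cst|]; exact: cvg_chord.
have Om : Omega (X s + (c / 2) *: T s).
  have := @open_chord (X s) y (1 / 2) (frontier_X s) cy.
  rewrite eq_sym => /(_ ys).
  rewrite {1}yE addrAC subrr add0r scalerA.
  rewrite (_ : 1 / 2 * c = c / 2); last by ring.
  by apply; apply/andP; split; lra.
move=> /(_ _ (open_nbhs_nbhs (conj oO Om))) [d /= d0 dO].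
(* The parameter [c * e] has the sign of [c], so that [X (s + c * e)] is on the
   side of the chord; [e <= 1 / 4] keeps it strictly between [X s] and a point
   of the neighborhood. *)
pose e := Num.min (d / (2 * `|c|)) (1 / 4).
have cg : 0 < `|c| by rewrite normr_gt0.
have e0 : 0 < e.
  rewrite lt_min; apply/andP; split; last lra.
  by rewrite divr_gt0 // mulr_gt0.
have e4 : e <= 1 / 4 by rewrite ge_min lexx orbT.
have he0 : c * e != 0 by rewrite mulf_neq0 // gt_eqF.
have hd : ball_ Num.norm 0 d (c * e).
  rewrite /ball_ /= sub0r normrN normrM (gtr0_norm e0).
  have : e <= d / (2 * `|c|) by rewrite ge_min lexx.
  rewrite ler_pdivlMr ?mulr_gt0 // => ?; nra.
have := dO _ hd he0; set b := (X in Omega X) => Ob.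
apply: (frontier_notin (frontier_X (s + c * e))).
have -> : X (s + c * e) = X s + (2 * e) *: (b - X s).
  rewrite /b addrAC subrr add0r !scalerA.
  rewrite (_ : 2 * e * (c / 2) * (c * e)^-1 = 1) ?scale1r ?subrKC //.
  by field; rewrite c0 gt_eqF.
apply: open_chord; first exact: frontier_X.
- exact: subset_closure.
- by apply/eqP => E; apply: (frontier_notin (frontier_X s)); rewrite E.
- by apply/andP; split; lra.
Qed.

Lemma int_lt1 (h : R) : h \is a Num.int -> `|h| < 1 -> h = 0.
Proof.
move=> /intrP[z ->]; rewrite -intr_norm -[1]/(1%:~R) ltr_int => z1.
by rewrite (_ : z = 0) //; lia.
Qed.

Lemma X_neq s h : 0 < h < 1 -> X (s + h) != X s.
Proof.
move=> /andP[h0 h1]; apply/eqP => /Xeq; rewrite addrAC subrr add0r => /int_lt1.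
by rewrite gtr0_norm // => /(_ h1) hE; rewrite hE ltxx in h0.
Qed.

Lemma dX_coord i (s : R) : is_derive s (1 : R) (fun t => X t 0 i) (T s 0 i).
Proof.
have [dXs <-] := dX s; rewrite derive_mx // mxE.
by apply: DeriveDef => //; move/derivable_mxP : dXs; apply.
Qed.

Lemma X_continuous i : continuous (fun s => X s 0 i).
Proof.
move=> s; apply/differentiable_continuous/derivable1_diffP.
by have [] := dX_coord i s.
Qed.

(** The transversality sign is constant because pairs of distinct boundary
    points form a connected strip. It tells on which side of its oriented
    tangent lines the table lies. *)
Lemma orientation : exists sg : R, sg * sg = 1 /\
  forall s h, 0 < h < 1 -> 0 < sg * sin_angle (T s) (X (s + h) - X s).
Proof.
pose D s h := sin_angle (T s) (X (s + h) - X s).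
have D0 s h : 0 < h < 1 -> D s h != 0.
  move=> h01; apply: tangent_transverse; last exact: X_neq.
  by have [] := frontier_X (s + h).
have h2 : 0 < (1 / 2 : R) < 1 by lra.
have sg2 : Num.sg (D 0 (1 / 2)) * Num.sg (D 0 (1 / 2)) = 1.
  by rewrite -expr2 sqr_sg D0.
exists (Num.sg (D 0 (1 / 2))); split => // s h h01.
pose phi t := D (t * s) (1 / 2 + t * (h - 1 / 2)).
have [h0 h1] := andP h01.
have in01 (t : R) : 0 <= t <= 1 -> 0 < 1 / 2 + t * (h - 1 / 2) < 1.
  by move=> /andP[t0 t1]; apply/andP; split; nra.
have cphi : continuous phi.
  have ca : continuous (fun t : R => t * s).
    by move=> t; apply: cvgM; [exact: cvg_id|exact: cvg_cst].
  have cb : continuous (fun t : R => t * s + (1 / 2 + t * (h - 1 / 2))).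
    move=> t; apply: cvgD; first exact: ca.
    apply: cvgD; first exact: cvg_cst.
    by apply: cvgM; [exact: cvg_id|exact: cvg_cst].
  have cTa i : continuous (fun t : R => T (t * s) 0 i).
    move=> t; apply: (cvg_comp (fun t : R => t * s) (fun u => T u 0 i)).
      exact: ca.
    exact: cT.
  have cXa i : continuous (fun t : R =>
      (X (t * s + (1 / 2 + t * (h - 1 / 2))) - X (t * s)) 0 i).
    have -> : (fun t : R =>
        (X (t * s + (1 / 2 + t * (h - 1 / 2))) - X (t * s)) 0 i) = (fun t : R =>
        X (t * s + (1 / 2 + t * (h - 1 / 2))) 0 i - X (t * s) 0 i).
      by apply/funext => t; rewrite !mxE.
    move=> t; apply: cvgB.
      apply: (cvg_comp (fun t : R => t * s + (1 / 2 + t * (h - 1 / 2)))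
        (fun u => X u 0 i)); [exact: cb|exact: X_continuous].
    apply: (cvg_comp (fun t : R => t * s) (fun u => X u 0 i)).
      exact: ca.
    exact: X_continuous.
  move=> t; apply: cvgB; apply: cvgM.
  - exact: cTa.
  - exact: cXa.
  - exact: cTa.
  - exact: cXa.
have p0 : phi 0 = D 0 (1 / 2) by rewrite /phi !mul0r addr0.
have p1 : phi 1 = D s h by rewrite /phi !mul1r addrC subrK.
have nz t : 0 <= t <= 1 -> phi t != 0 by move=> /in01; exact: D0.
have ivt : ~ (Num.min (phi 0) (phi 1) <= 0 <= Num.max (phi 0) (phi 1)).
  move=> H; have [t] := IVT ler01 (continuous_subspaceT cphi) H.
  by rewrite in_itv /= => /nz /eqP.
rewrite -/(D s h) -p1 -p0.
have n0 : phi 0 != 0 by apply: nz; rewrite lexx ler01.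
have n1 : phi 1 != 0 by apply: nz; rewrite lexx ler01.
rewrite ltNge; apply/negP => le0; apply: ivt.
case: (ltgtP (phi 0) 0) le0 n0 => // phi0.
  rewrite ltr0_sg // mulN1r oppr_le0 => phi1 _.
  by rewrite le_max phi1 orbT ge_min (ltW phi0).
rewrite gtr0_sg // mul1r => phi1 _.
by rewrite ge_min phi1 orbT le_max (ltW phi0).
Qed.

Lemma X_per s z : z \is a Num.int -> X (s + z) = X s.
Proof. by move=> zi; apply/Xeq; rewrite addrAC subrr add0r. Qed.

Lemma T_per s z : z \is a Num.int -> T (s + z) = T s.
Proof.
move=> zi; have H := @cvg_chord (s + z).
have E : (fun h : R => h^-1 *: (X (s + z + h) - X (s + z))) =
    (fun h : R => h^-1 *: (X (s + h) - X s)).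
  by apply/funext => h; rewrite addrAC !(X_per _ zi).
by rewrite E in H; exact: (cvg_unique (@norm_hausdorff _ _) H (@cvg_chord s)).
Qed.

(** The chord from [X s] to [X (s + h)] divided by [h * (1 - h)], see [chordE].
    As a difference of divided differences, over [[s, s + h]] and over
    [[s + h - 1, s]], it makes sense for [h = 0] and [h = 1]. *)
Definition chord_slope (s h : R) : 'rV[R]_2 :=
  \row_i (slope (fun t => X t 0 i) (fun t => T t 0 i) s h -
          slope (fun t => X t 0 i) (fun t => T t 0 i) s (h - 1)).

Lemma chord_slope0 s : chord_slope s 0 = T s.
Proof.
apply/rowP => i; rewrite !mxE /slope eqxx sub0r oppr_eq0 oner_eq0.
by rewrite X_per ?rpredN ?rpred1 // subrr mul0r subr0.
Qed.

Lemma chord_slope1 s : chord_slope s 1 = - T s.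
Proof.
apply/rowP => i; rewrite !mxE /slope subrr eqxx oner_eq0.
by rewrite X_per ?rpred1 // subrr mul0r sub0r.
Qed.

Lemma chordE s h : X (s + h) - X s = (h * (1 - h)) *: chord_slope s h.
Proof.
have [->|h0] := eqVneq h 0; first by rewrite addr0 subrr mul0r scale0r.
have [->|h1] := eqVneq h 1.
  by rewrite X_per ?rpred1 // !subrr mulr0 scale0r.
have h1' : h - 1 != 0 by rewrite subr_eq0.
apply/rowP => i; rewrite !mxE /slope (negbTE h0) (negbTE h1').
rewrite addrA (@X_per (s + h) (- 1)) ?rpredN ?rpred1 //.
by field; rewrite h0 h1'.
Qed.

Lemma chord_slope_continuous i :
  continuous (fun p : R * R => chord_slope p.1 p.2 0 i).
Proof.
have -> : (fun p : R * R => chord_slope p.1 p.2 0 i) = (fun p : R * R =>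
    slope (fun t => X t 0 i) (fun t => T t 0 i) p.1 p.2 -
    slope (fun t => X t 0 i) (fun t => T t 0 i) p.1 (p.2 - 1)).
  by apply/funext => p; rewrite mxE.
have cs := slope_continuous (dX_coord i) (cT (i := i)).
move=> p; apply: cvgB; first exact: cs.
apply: (@continuous_comp _ _ _ (fun p : R * R => (p.1, p.2 - 1))
  (fun p : R * R => slope (fun t => X t 0 i) (fun t => T t 0 i) p.1 p.2));
  last exact: cs.
apply: (@cvg_pair _ _ _ (nbhs p) (nbhs p.1) (nbhs (p.2 - 1))).
  exact: cvg_fst.
by apply: cvgB; [exact: cvg_snd|exact: cvg_cst].
Qed.

(** * Chords and their directions *)

Section Oriented.
Variable sg : R.
Hypothesis sg2 : sg * sg = 1.
Hypothesis sg_pos : forall s h, 0 < h < 1 ->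
  0 < sg * sin_angle (T s) (X (s + h) - X s).

(** The inward unit normal: [sg] compensates for the orientation of the
    parametrization. *)
Definition normal (s : R) : 'rV[R]_2 := - sg *: rotN (T s).

Definition velocity (s r : R) : 'rV[R]_2 :=
  Num.sqrt (1 - r ^+ 2) *: normal s + (r * sg) *: T s.

(** The chord over [[s, s + h]] leaves [X s] at an angle of sine [r] to the
    normal. Without division, the condition is closed; for [h = 0] and [h = 1]
    it singles out the two tangent directions. *)
Definition chord_rel (s r h : R) : Prop :=
  0 <= h <= 1 /\
  r * enorm (chord_slope s h) = sg * dot (chord_slope s h) (T s).

Lemma cross_chord_slope s h : 0 < h < 1 ->
  0 < sg * sin_angle (T s) (chord_slope s h).
Proof.
move=> h01; have := sg_pos s h01; have [h0 h1] := andP h01.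
have hh : 0 < h * (1 - h) by rewrite mulr_gt0 // subr_gt0.
rewrite chordE /sin_angle !mxE.
set a := slope _ _ _ _ - _; set b := slope _ _ _ _ - _.
have -> : sg * (T s 0 0 * (h * (1 - h) * a) - T s 0 1 * (h * (1 - h) * b)) =
  (h * (1 - h)) * (sg * (T s 0 0 * a - T s 0 1 * b)) by ring.
by rewrite pmulr_rgt0.
Qed.

Lemma chord_slope_neq0 s h : 0 <= h <= 1 -> chord_slope s h != 0.
Proof.
have T0 : T s != 0.
  apply/eqP => T0; move: (uT s); rewrite T0 dotE !mxE mul0r addr0 => /eqP.
  by rewrite eq_sym oner_eq0.
have [->|h0] := eqVneq h 0; first by rewrite chord_slope0.
have [->|h1] := eqVneq h 1; first by rewrite chord_slope1 oppr_eq0.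
move=> /andP[h0' h1']; have /cross_chord_slope : 0 < h < 1.
  by rewrite !lt_neqAle h1 eq_sym h0 h0' h1'.
move=> /(_ s); apply: contraTneq => ->.
by rewrite /sin_angle !mxE !mulr0 subrr mulr0 ltxx.
Qed.

Lemma chord_slope_norm s h : 0 <= h <= 1 -> 0 < enorm (chord_slope s h).
Proof.
by move=> h01; rewrite lt_neqAle eq_sym enorm_eq0 enorm_ge0 chord_slope_neq0.
Qed.

(** The relation fixes the tangential component of the chord. Lagrange's
    identity gives the normal one up to sign, and the chord points inward. *)
Lemma chord_rel_interior s r h : 0 < h < 1 -> chord_rel s r h ->
  `|r| < 1 /\ chord_slope s h = enorm (chord_slope s h) *: velocity s r.
Proof.
move=> h01 [h01' K]; have e0 := chord_slope_norm s h01'.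
have cp := cross_chord_slope s h01.
have L := dot_cross_sqr (T s) (chord_slope s h).
rewrite uT mul1r -sqr_enorm in L.
have D : dot (T s) (chord_slope s h) = sg * r * enorm (chord_slope s h).
  by rewrite -mulrA K mulrA sg2 mul1r dotC.
move: L cp e0 D; set e := enorm _; set c := sin_angle _ _; set d := dot _ _.
move=> L cp e0 D.
have r2 : (1 - r ^+ 2) * e ^+ 2 = (sg * c) ^+ 2.
  rewrite [RHS]exprMn [sg ^+ 2]expr2 sg2 mul1r.
  have -> : c ^+ 2 = e ^+ 2 - d ^+ 2 by rewrite -L; ring.
  rewrite D !exprMn [sg ^+ 2]expr2 sg2; ring.
have r1 : 0 < 1 - r ^+ 2.
  by rewrite -(pmulr_lgt0 _ (exprn_gt0 2 e0)) r2 exprn_gt0.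
split.
  by rewrite -(@expr_lt1 _ 2) // real_normK ?num_real // -subr_gt0.
have sq : Num.sqrt (1 - r ^+ 2) * e = sg * c.
  rewrite -(gtr0_norm cp) -sqrtr_sqr -r2 sqrtrM ?ltW //.
  by rewrite sqrtr_sqr gtr0_norm.
rewrite [LHS](frame_decomposition _ (uT s)) -/c dotC -/d D /velocity /normal.
rewrite scalerDr !scalerA.
have -> : e * Num.sqrt (1 - r ^+ 2) * - sg = - c.
  have -> : e * Num.sqrt (1 - r ^+ 2) * - sg =
     - sg * (Num.sqrt (1 - r ^+ 2) * e) by ring.
  by rewrite sq mulrA mulNr sg2 mulN1r.
by rewrite addrC scaleNr (_ : e * (r * sg) = sg * r * e) //; ring.
Qed.

Lemma enorm_T s : enorm (T s) = 1.
Proof. exact/enorm1P. Qed.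

Lemma chord_rel0 s r : chord_rel s r 0 <-> r = sg.
Proof.
rewrite /chord_rel chord_slope0 enorm_T uT !mulr1 lexx ler01.
by split => [[]|].
Qed.

Lemma chord_rel1 s r : chord_rel s r 1 <-> r = - sg.
Proof.
rewrite /chord_rel chord_slope1.
have -> : enorm (- T s) = 1.
  by rewrite /enorm -scaleN1r dotZl dotZr uT mulr1 mulrNN mulr1 sqrtr1.
have -> : dot (- T s) (T s) = - 1 by rewrite -scaleN1r dotZl uT mulr1.
by rewrite mulr1 mulrN1 lexx ler01; split => [[]|].
Qed.

Lemma sg_neqN : sg != - sg.
Proof.
rewrite -addr_eq0 -mulr2n mulrn_eq0 /=; apply/eqP => sg0.
by move: sg2; rewrite sg0 mul0r => /eqP; rewrite eq_sym oner_eq0.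
Qed.

Lemma norm_sg : `|sg| = 1.
Proof.
apply/eqP; rewrite -(@eqrXn2 _ 2) // expr1n real_normK ?num_real //.
by rewrite expr2 sg2.
Qed.

Lemma itv_endpoints (h : R) : 0 <= h <= 1 -> [\/ h = 0, h = 1 | 0 < h < 1].
Proof.
have [->|h0] := eqVneq h 0; first by constructor 1.
have [->|h1] := eqVneq h 1; first by constructor 2.
by constructor 3; rewrite !lt_neqAle eq_sym h0 h1.
Qed.

Lemma chord_rel_end s r h : chord_rel s r h -> `|r| < 1 -> 0 < h < 1.
Proof.
move=> K r1; case: (itv_endpoints (proj1 K)) => // hE; move: K; rewrite hE.
  by move=> /chord_rel0 rE; rewrite rE norm_sg ltxx in r1.
by move=> /chord_rel1 rE; rewrite rE normrN norm_sg ltxx in r1.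
Qed.

Lemma chord_velocity s r h : 0 < h < 1 -> chord_rel s r h ->
  exists2 t, 0 < t & X (s + h) = X s + t *: velocity s r.
Proof.
move=> h01 K; have [_ cE] := chord_rel_interior h01 K.
exists (h * (1 - h) * enorm (chord_slope s h)).
  have [h0 h1] := andP h01.
  by rewrite !mulr_gt0 ?subr_gt0 // chord_slope_norm //; case: K.
by rewrite -scalerA -cE -chordE subrKC.
Qed.

Lemma dot_normal_normal s : dot (normal s) (normal s) = 1.
Proof.
rewrite -(uT s) !dotE !mxE /=.
rewrite -[RHS]mul1r -sg2; ring.
Qed.

Lemma dot_normal_T s : dot (normal s) (T s) = 0.
Proof. by rewrite !dotE !mxE /=; ring. Qed.

Lemma rotN_normal s : rotN (normal s) = sg *: T s.
Proof. by apply: plane_eq; rewrite !mxE /=; ring. Qed.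

Lemma velocity_unit s r : `|r| <= 1 -> dot (velocity s r) (velocity s r) = 1.
Proof.
move=> r1; have r2 : 0 <= 1 - r ^+ 2.
  by rewrite subr_ge0 -real_normK ?num_real // expr_le1.
have dot2 a b u v : dot (a *: u + b *: v) (a *: u + b *: v) =
    a ^+ 2 * dot u u + 2 * a * b * dot u v + b ^+ 2 * dot v v.
  by rewrite !dotE !mxE; ring.
rewrite /velocity dot2 dot_normal_normal dot_normal_T uT sqr_sqrtr //.
by rewrite exprMn [sg ^+ 2]expr2 sg2; ring.
Qed.

Lemma velocity_neq0 s r : `|r| <= 1 -> velocity s r != 0.
Proof.
move=> r1; apply: contraTneq isT => v0.
have := velocity_unit s r1; rewrite v0 dotE !mxE mul0r addr0 => /eqP.
by rewrite eq_sym oner_eq0.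
Qed.

(** Two chords with the same direction end at the same point, by strict
    convexity. Grazing directions correspond to the two end points of the
    interval, one for each sign of [r]. *)
Lemma chord_rel_unique s r h1 h2 : chord_rel s r h1 -> chord_rel s r h2 ->
  h1 = h2.
Proof.
have main h h' : 0 < h < 1 -> chord_rel s r h -> chord_rel s r h' -> h = h'.
  move=> h01 K K'; have [r1 _] := chord_rel_interior h01 K.
  have h01' := chord_rel_end K' r1.
  have [t t0 tE] := chord_velocity h01 K.
  have [t' t0' tE'] := chord_velocity h01' K'.
  have tt : t = t'.
    apply: (frontier_ray_unique (velocity_neq0 s (ltW r1)) t0 t0').
    - exact: frontier_X s.
    - by rewrite -tE; exact: frontier_X.
    - by rewrite -tE'; exact: frontier_X.
  have : X (s + h) = X (s + h') by rewrite tE tE' tt.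
  move=> /Xeq; rewrite opprD addrACA subrr add0r => /int_lt1 hh.
  apply/eqP; rewrite -subr_eq0 hh // ltr_norml.
  by move: h01 h01' => /andP[? ?] /andP[? ?]; lra.
move=> K1 K2.
case: (itv_endpoints (proj1 K1)) => h1E; last exact: main.
- case: (itv_endpoints (proj1 K2)) => h2E; last by apply/esym; exact: main.
    by rewrite h1E h2E.
  move: K1 K2; rewrite h1E h2E => /chord_rel0 -> /chord_rel1 /eqP.
  by rewrite (negbTE sg_neqN).
- case: (itv_endpoints (proj1 K2)) => h2E; last by apply/esym; exact: main.
    move: K1 K2; rewrite h1E h2E => /chord_rel1 -> /chord_rel0 /eqP.
    by rewrite eq_sym (negbTE sg_neqN).
  by rewrite h1E h2E.
Qed.

Lemma chord_dot_continuous : continuous (fun p : R * R =>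
  sg * dot (chord_slope p.1 p.2) (T p.1)).
Proof.
move=> p; apply: cvgM; first exact: cvg_cst.
move: p; apply: dot_continuous; first exact: chord_slope_continuous.
move=> i p; apply: (cvg_comp (fun p : R * R => p.1) (fun u => T u 0 i)).
  exact: cvg_fst.
exact: cT.
Qed.

Lemma chord_enorm_continuous : continuous (fun p : R * R =>
  enorm (chord_slope p.1 p.2)).
Proof. exact/enorm_continuous/chord_slope_continuous. Qed.

Lemma chord_rel_exists s r : `|r| <= 1 -> exists h, chord_rel s r h.
Proof.
move=> r1; pose g h := sg * dot (chord_slope s h) (T s) -
  r * enorm (chord_slope s h).
have cs : continuous (fun h : R => (s, h)).
  by move=> h; apply: (@cvg_pair _ _ _ (nbhs h) (nbhs s) (nbhs h));
    [exact: cvg_cst|exact: cvg_id].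
have cg : continuous g.
  move=> h; apply: cvgB.
    apply: (@continuous_comp _ _ _ (fun h : R => (s, h)) (fun p : R * R =>
      sg * dot (chord_slope p.1 p.2) (T p.1))); first exact: cs.
    exact: chord_dot_continuous.
  apply: cvgM; first exact: cvg_cst.
  apply: (@continuous_comp _ _ _ (fun h : R => (s, h)) (fun p : R * R =>
      enorm (chord_slope p.1 p.2))); first exact: cs.
  exact: chord_enorm_continuous.
have g0 : g 0 = sg - r by rewrite /g chord_slope0 uT enorm_T !mulr1.
have g1 : g 1 = - sg - r.
  rewrite /g chord_slope1 -scaleN1r dotZl uT mulr1 mulrN1; congr (_ - _).
  by rewrite /enorm dotZl dotZr uT mulr1 mulrNN mulr1 sqrtr1 mulr1.
have : Num.min (g 0) (g 1) <= 0 <= Num.max (g 0) (g 1).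
  rewrite g0 g1 ge_min le_max.
  have /andP[rl ru] : - 1 <= r <= 1 by rewrite -ler_norml.
  have : (sg - 1) * (sg + 1) = 0.
    by transitivity (sg * sg - 1); [ring|rewrite sg2 subrr].
  move=> /eqP; rewrite mulf_eq0 subr_eq0 addr_eq0 => /orP[]/eqP ->.
    by apply/andP; split; apply/orP; [right|left]; lra.
  by apply/andP; split; apply/orP; [left|right]; lra.
move=> /(IVT ler01 (continuous_subspaceT cg))[h].
rewrite in_itv /= => h01 /eqP; rewrite subr_eq0 => /eqP gh.
by exists h; split.
Qed.

(** Clamping the sine makes [arc] a total function that is continuous on the
    whole plane, so no restriction to the closed strip is carried around. *)
Definition clamp (r : R) : R := Num.max (- 1) (Num.min 1 r).

Lemma clamp_le1 r : `|clamp r| <= 1.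
Proof.
rewrite ler_norml /clamp le_max lexx /= ge_max ge_min lexx andbT /=.
by lra.
Qed.

Lemma clamp_id r : `|r| <= 1 -> clamp r = r.
Proof. by rewrite ler_norml /clamp => /andP[? ?]; rewrite min_r // max_r. Qed.

Lemma clamp_continuous : continuous clamp.
Proof.
move=> r; have -> : clamp = (fun=> - 1 : R^o) \max ((fun=> 1 : R^o) \min id).
  by apply/funext => x.
apply: continuous_max; first exact: cvg_cst.
by apply: continuous_min; [exact: cvg_cst|exact: cvg_id].
Qed.

Definition arc (s r : R) : R := xget 0 [set h | chord_rel s (clamp r) h].

Lemma arcP s r : chord_rel s (clamp r) (arc s r).
Proof.
rewrite /arc; case: xgetP => //= none.
by have [h /none] := chord_rel_exists s (clamp_le1 r).
Qed.

(** The chord relation is closed and determines the arc, so continuity at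
    grazing incidence requires no estimate. *)
Lemma arc_continuous : continuous (fun p : R * R => arc p.1 p.2).
Proof.
apply: (@closed_graph_continuous _ _ _ 0 1).
  by move=> p; have [] := arcP p.1 p.2.
have -> : [set p : (R * R) * R | p.2 = arc p.1.1 p.1.2] =
    [set p | 0 <= p.2] `&` [set p | p.2 <= 1] `&`
    [set p | clamp p.1.2 * enorm (chord_slope p.1.1 p.2) -
       sg * dot (chord_slope p.1.1 p.2) (T p.1.1) = 0].
  apply/seteqP; split => -[[s r] h] /=.
    move=> ->; have [/andP[h0 h1] ->] := arcP s r.
    by rewrite subrr.
  move=> [[h0 h1] /eqP]; rewrite subr_eq0 => /eqP K.
  apply: (chord_rel_unique (s := s) (r := clamp r)); last exact: arcP.
  by split => //; rewrite h0.
apply: closedI; first apply: closedI.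
- apply: (@preimage_closed _ _ snd [set x : R | 0 <= x]); last exact: closed_ge.
  by move=> p _; exact: cvg_snd.
- apply: (@preimage_closed _ _ snd [set x : R | x <= 1]); last exact: closed_le.
  by move=> p _; exact: cvg_snd.
- apply: (@preimage_closed _ _ (fun p : R * R * R =>
    clamp p.1.2 * enorm (chord_slope p.1.1 p.2) -
       sg * dot (chord_slope p.1.1 p.2) (T p.1.1)) [set x : R | x = 0]);
    last exact: closed_eq.
  move=> p _.
  have c1 : {for p, continuous (fun p : R * R * R => (p.1.1, p.2))}.
    apply: (@cvg_pair _ _ _ (nbhs p) (nbhs p.1.1) (nbhs p.2));
      last exact: cvg_snd.
    by apply: (cvg_comp (fun p : R * R * R => p.1) (fun q : R * R => q.1));
      exact: cvg_fst.
  apply: cvgB; last first.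
    apply: (@continuous_comp _ _ _ (fun p : R * R * R => (p.1.1, p.2))
      (fun p : R * R => sg * dot (chord_slope p.1 p.2) (T p.1))).
      exact: c1.
    exact: chord_dot_continuous.
  apply: cvgM; last first.
    apply: (@continuous_comp _ _ _ (fun p : R * R * R => (p.1.1, p.2))
      (fun p : R * R => enorm (chord_slope p.1 p.2))).
      exact: c1.
    exact: chord_enorm_continuous.
  apply: (@continuous_comp _ _ _ (fun p : R * R * R => p.1.2) clamp);
    last exact: clamp_continuous.
  by apply: (cvg_comp (fun p : R * R * R => p.1) (fun q : R * R => q.2));
    [exact: cvg_fst|exact: cvg_snd].
Qed.

Lemma chord_slope_per s z h : z \is a Num.int ->
  chord_slope (s + z) h = chord_slope s h.
Proof.
move=> zi; apply/rowP => i; rewrite !mxE /slope (T_per _ zi).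
by rewrite !(addrAC s z) !(X_per _ zi).
Qed.

Lemma chord_rel_per s z r h : z \is a Num.int ->
  chord_rel (s + z) r h -> chord_rel s r h.
Proof. by move=> zi; rewrite /chord_rel chord_slope_per // T_per. Qed.

(** The sine of the reflected angle: reflection preserves the tangential
    component of the velocity. *)
Definition out_sine (s r : R) : R :=
  sg * dot (velocity s (clamp r)) (T (s + arc s r)).

Lemma out_sine_le1 s r : `|out_sine s r| <= 1.
Proof.
rewrite normrM norm_sg mul1r; apply: dot_le1 => //.
exact/velocity_unit/clamp_le1.
Qed.

Lemma dot_velocity_T s r : dot (velocity s r) (T s) = r * sg.
Proof.
have dot_lin b c u v w : dot (b *: u + c *: v) w = b * dot u w + c * dot v w.
  by rewrite !dotE !mxE; ring.
by rewrite /velocity dot_lin dot_normal_T uT mulr0 add0r mulr1.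
Qed.

Lemma arc_interior s r : `|r| < 1 -> 0 < arc s r < 1.
Proof.
move=> r1; have := arcP s r; rewrite clamp_id ?ltW // => K.
exact: chord_rel_end K r1.
Qed.

Lemma arc_boundary s r : `|r| = 1 -> arc s r = 0 \/ arc s r = 1.
Proof.
move=> r1; have := arcP s r; rewrite clamp_id ?r1 // => K.
case: (itv_endpoints (proj1 K)) => h01; [by left|by right|].
by have [] := chord_rel_interior h01 K; rewrite r1 ltxx.
Qed.

Lemma arc_int s r : `|r| = 1 -> arc s r \is a Num.int.
Proof. by move=> /(arc_boundary s)[] ->; rewrite ?rpred0 ?rpred1. Qed.

Lemma out_sine_boundary s r : `|r| = 1 -> out_sine s r = r.
Proof.
move=> r1; rewrite /out_sine T_per; last exact: arc_int.
by rewrite clamp_id ?r1 // dot_velocity_T mulrCA sg2 mulr1.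
Qed.

(** Time reversal: the chord issued from the end point with the opposite sine
    goes back to the starting point. *)
Lemma chord_rel_reverse s r : `|r| < 1 ->
  chord_rel (s + arc s r) (- out_sine s r) (1 - arc s r).
Proof.
move=> r1; have h01 := arc_interior s r1.
have := arcP s r; rewrite /out_sine clamp_id ?ltW // => K.
set h := arc s r in h01 K *; have [h0 h1] := andP h01.
have h0' : 0 <= 1 - h <= 1 by apply/andP; split; lra.
have hh : h * (1 - h) != 0 by rewrite mulf_neq0 ?gt_eqF // subr_gt0.
have QE : chord_slope (s + h) (1 - h) = - chord_slope s h.
  apply: (scalerI hh); rewrite scalerN -chordE opprB.
  have := chordE (s + h) (1 - h).
  rewrite addrACA subrr addr0 X_per ?rpred1 // => ->.
  by rewrite subKr mulrC.
split => //; rewrite QE.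
have -> : enorm (- chord_slope s h) = enorm (chord_slope s h).
  by rewrite /enorm -scaleN1r dotZl dotZr mulN1r mulN1r opprK.
have [_ cE] := chord_rel_interior h01 K.
have -> : dot (- chord_slope s h) (T (s + h)) =
    - (enorm (chord_slope s h) * dot (velocity s r) (T (s + h))).
  by rewrite {1}cE -scaleN1r scalerA dotZl mulN1r mulNr.
by ring.
Qed.

Lemma out_sine_interior s r : `|r| < 1 -> `|out_sine s r| < 1.
Proof.
move=> r1; rewrite -normrN.
have h01 : 0 < 1 - arc s r < 1.
  by have /andP[? ?] := arc_interior s r1; apply/andP; split; lra.
by have [] := chord_rel_interior h01 (chord_rel_reverse s r1).
Qed.

Lemma step_injective s1 r1 s2 r2 : `|r1| <= 1 -> `|r2| <= 1 ->
  (s1 + arc s1 r1) - (s2 + arc s2 r2) \is a Num.int ->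
  out_sine s1 r1 = out_sine s2 r2 -> s1 - s2 \is a Num.int /\ r1 = r2.
Proof.
rewrite !le_eqVlt => /orP[/eqP b1|i1] /orP[/eqP b2|i2] zint.
- rewrite !out_sine_boundary // => ->; split => //.
  rewrite (_ : s1 - s2 =
    s1 + arc s1 r1 - (s2 + arc s2 r2) - arc s1 r1 + arc s2 r2).
    by apply: rpredD; [apply: rpredB => //|]; exact: arc_int.
  by ring.
- rewrite out_sine_boundary // => r1E.
  by have := out_sine_interior s2 i2; rewrite -r1E b1 ltxx.
- rewrite [RHS]out_sine_boundary // => r2E.
  by have := out_sine_interior s1 i1; rewrite r2E b2 ltxx.
move=> oE; have K2 := chord_rel_reverse s2 i2.
have := chord_rel_reverse s1 i1; rewrite oE.
rewrite -[s1 + _](subrKC (s2 + arc s2 r2)) => /(chord_rel_per zint) K1.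
have hE : arc s1 r1 = arc s2 r2.
  by have := chord_rel_unique K1 K2; lra.
have sint : s1 - s2 \is a Num.int.
  by move: zint; rewrite hE opprD addrACA subrr addr0.
split => //.
have := arcP s1 r1; rewrite clamp_id ?ltW // hE -[s1](subrKC s2).
move=> /(chord_rel_per sint) [h01 E1].
have := arcP s2 r2; rewrite clamp_id ?ltW // => -[_ E2].
apply: (mulIf (x := enorm (chord_slope s2 (arc s2 r2)))); last by rewrite E1 E2.
by rewrite gt_eqF // chord_slope_norm.
Qed.

Lemma step_continuous : continuous (fun p : R * R => p.1 + arc p.1 p.2) /\
  continuous (fun p : R * R => out_sine p.1 p.2).
Proof.
have c1 : continuous (fun p : R * R => p.1 + arc p.1 p.2).
  by move=> p; apply: cvgD; [exact: cvg_fst|exact: arc_continuous].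
split => //.
have cTf (i : 'I_2) (g : R * R -> R) : continuous g ->
    continuous (fun p => T (g p) 0 i).
  move=> cg p; apply: (@continuous_comp _ _ _ g (fun u => T u 0 i)).
    exact: cg.
  exact: cT.
have c2 : continuous (fun p : R * R => clamp p.2).
  move=> p; apply: (@continuous_comp _ _ _ (fun p : R * R => p.2) clamp).
    exact: cvg_snd.
  exact: clamp_continuous.
have cf : continuous (fun p : R * R => p.1) by move=> p; exact: cvg_fst.
move=> p; apply: cvgM; first exact: cvg_cst.
move: p; apply: dot_continuous; last by move=> i; apply: cTf.
move=> i.
have -> : (fun p : R * R => velocity p.1 (clamp p.2) 0 i) = (fun p =>
    Num.sqrt (1 - clamp p.2 * clamp p.2) *
      (- sg * (if i == 0 then T p.1 0 1 else - T p.1 0 0)) +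
    clamp p.2 * sg * T p.1 0 i).
  by apply/funext => p; rewrite !mxE expr2.
move=> p; apply: cvgD; apply: cvgM.
- apply: (@continuous_comp _ _ _
    (fun p : R * R => 1 - clamp p.2 * clamp p.2) Num.sqrt).
    by apply: cvgB; [exact: cvg_cst|apply: cvgM; exact: c2].
  exact: sqrt_continuous.
- apply: cvgM; first exact: cvg_cst.
  case: (i == 0); first exact: cTf.
  by apply: cvgN; exact: cTf.
- by apply: cvgM; [exact: c2|exact: cvg_cst].
- exact: cTf.
Qed.

(** The perpendicular chord ends where the projection of the chords on the
    tangent direction changes sign, so overshooting detects its position. *)
Lemma arc0_lt s h : 0 < h < 1 -> dot (X (s + h) - X s) (T s) < 0 ->
  arc s 0 < h.
Proof.
move=> h01; have [h0 h1] := andP h01.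
rewrite chordE dotZl pmulr_rlt0 ?mulr_gt0 ?subr_gt0 // => neg.
pose g u := sg * (sg * dot (chord_slope s u) (T s)).
have gE u : g u = dot (chord_slope s u) (T s) by rewrite /g mulrA sg2 mul1r.
have cg : continuous g.
  move=> u; apply: cvgM; first exact: cvg_cst.
  apply: (@continuous_comp _ _ _ (fun h : R => (s, h)) (fun p : R * R =>
      sg * dot (chord_slope p.1 p.2) (T p.1)));
    last exact: chord_dot_continuous.
  by apply: (@cvg_pair _ _ _ (nbhs u) (nbhs s) (nbhs u));
    [exact: cvg_cst|exact: cvg_id].
have : Num.min (g 0) (g h) <= 0 <= Num.max (g 0) (g h).
  by rewrite !gE chord_slope0 uT ge_min le_max ler01 (ltW neg) orbT.
move=> /(IVT (ltW h0) (continuous_subspaceT cg))[c].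
rewrite in_itv /= => /andP[c0 ch] gc.
have -> : arc s 0 = c.
  apply: (chord_rel_unique (s := s) (r := 0)).
    by have := arcP s 0; rewrite clamp_id // normr0 ler01.
  split; first by rewrite c0 (le_trans ch) ?ltW.
  by rewrite mul0r -gE gc mulr0.
rewrite lt_neqAle ch andbT; apply: contraTneq neg => <-.
by rewrite -gE gc ltxx.
Qed.

(** The left-hand side of the hypothesis is [tau * |curvature|]. Moving [a]
    forward while keeping the end point fixed, the projection of the chord on
    the tangent direction starts from [0] with derivative at most
    [-1 + tau * |curvature|], hence becomes negative: the perpendicular chord
    from the new point ends strictly before. *)
Lemma retrograde a (K : 'rV[R]_2) :
  (forall i, is_derive a (1 : R) (fun t : R => T t 0 i) (K 0 i)) ->
  enorm (X (a + arc a 0) - X a) * enorm K < 1 ->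
  exists2 b, a < b & b + arc b 0 < a + arc a 0.
Proof.
move=> dK small; set G := a + arc a 0 in small *.
have /andP[h0 h1] : 0 < arc a 0 < 1 by apply: arc_interior; rewrite normr0.
pose g s := dot (X G - X s) (T s).
have gE : g = (cst (X G 0 0) - (fun s => X s 0 0)) * (fun s => T s 0 0) +
    (cst (X G 0 1) - (fun s => X s 0 1)) * (fun s => T s 0 1).
  by apply/funext => s; rewrite /g dotE !mxE.
have dg : is_derive a (1 : R) g (dot (X G - X a) K - 1).
  rewrite gE; apply: is_derive_eq.
    apply: is_deriveD; apply: is_deriveM.
    - by apply: is_deriveB; exact: dX_coord.
    - by apply: is_deriveB; exact: dX_coord.
  rewrite -(uT a) !dotE !mxE /= /GRing.scale /=.
  rewrite -[(cst _ - _) a]/(X G 0 0 - X a 0 0).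
  rewrite -[(cst _ - _) a]/(X G 0 1 - X a 0 1).
  by ring.
have d0 : dot (X G - X a) K - 1 < 0.
  by rewrite subr_lt0 (le_lt_trans (dot_le_enorm _ _)).
have aG : a < G by rewrite ltrDl.
have [b /andP[ab bG] gb] := derive_lt0_right dg d0 aG.
have ga : g a = 0.
  rewrite /g /G chordE dotZl.
  have [_] := arcP a 0; rewrite clamp_id ?normr0 ?ler01 // mul0r => /esym /eqP.
  rewrite mulf_eq0 => /orP[/eqP sg0|/eqP ->]; last by rewrite mulr0.
  by move: sg_neqN; rewrite sg0 oppr0 eqxx.
exists b => //; rewrite -ltrBrDl; apply: arc0_lt.
  by apply/andP; split; rewrite /G in bG *; lra.
by rewrite subrKC; rewrite ga in gb.
Qed.

Lemma arc_per s z r : z \is a Num.int -> arc (s + z) r = arc s r.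
Proof.
move=> zi; apply: (chord_rel_unique _ (arcP s r)).
exact/(chord_rel_per zi)/arcP.
Qed.

(** * The billiard map *)

Section Billiard.
Variable Ups : circle R -> 'rV[R]_2.
Hypothesis XE : forall s, Ups (to_circle s) = X s.
Hypothesis TE : forall s, circle_derive 1 Ups (to_circle s) = T s.

Lemma Ups_inj (p q : circle R) : Ups p = Ups q -> p = q.
Proof.
by rewrite -(lift_circleK p) -(lift_circleK q) !XE => /Xeq /to_circleP.
Qed.

Lemma velocity0 s : velocity s 0 = normal s.
Proof.
by rewrite /velocity expr0n subr0 sqrtr1 scale1r mul0r scale0r addr0.
Qed.

Lemma arc_velocity s r : `|r| < 1 ->
  exists2 t, 0 < t & X (s + arc s r) = X s + t *: velocity s r.
Proof.
move=> r1; apply: chord_velocity; first exact: arc_interior.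
by have := arcP s r; rewrite clamp_id // ltW.
Qed.

(** Strict convexity puts the perpendicular chord inside the table. *)
Lemma near_normal s : \forall t \near (0 : R)^'+, Omega (X s + t *: normal s).
Proof.
have r0 : `|0 : R| < 1 by rewrite normr0.
have [t0 t0g tE] := arc_velocity s r0; rewrite velocity0 in tE.
near=> t.
have tg : 0 < t by near: t; exact: nbhs_right_gt.
have -> : X s + t *: normal s =
    X s + (t / t0) *: (X (s + arc s 0) - X s).
  by rewrite tE addrAC subrr add0r (scalerA _ t0) divfK // gt_eqF.
apply: open_chord.
- exact: frontier_X.
- by have [] := frontier_X (s + arc s 0).
- by rewrite eq_sym; apply/X_neq/arc_interior.
- rewrite divr_gt0 //= ltr_pdivrMr // mul1r.
  by near: t; exact: nbhs_right_lt.
Unshelve. all: by end_near. Qed.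

Lemma inward_normalE s : inward_normal Omega Ups (to_circle s) = normal s.
Proof.
rewrite /inward_normal TE XE; apply: xget_unique => /=.
  split; [exact/enorm1P/dot_normal_normal|exact: dot_normal_T|].
  exact: near_normal.
move=> y [/enorm1P y1 yT yO].
have := frame_decomposition y (uT s); rewrite yT scale0r sub0r => yE.
have := dot_cross_sqr (T s) y; rewrite uT y1 dotC yT expr0n add0r mulr1.
set c := sin_angle _ _ in yE *.
move=> c2; have : (c - sg) * (c + sg) = 0.
  by transitivity (c ^+ 2 - sg * sg); [ring|rewrite c2 sg2 subrr].
move=> /eqP; rewrite mulf_eq0 subr_eq0 addr_eq0 => /orP[/eqP cE|/eqP cE].
  by rewrite yE cE /normal scaleNr.
(* The opposite normal would put the boundary point inside a chord. *)
have yN : y = - normal s by rewrite yE cE /normal scaleNr.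
have [t [Ot1 Ot2 tg]] : exists t, [/\ Omega (X s + t *: normal s),
    Omega (X s + t *: y) & 0 < t].
  have : \forall t \near (0 : R)^'+, [/\ Omega (X s + t *: normal s),
    Omega (X s + t *: y) & 0 < t].
    near=> t; split; near: t.
    - exact: near_normal.
    - exact: yO.
    - exact: nbhs_right_gt.
  by move=> /filter_ex.
exfalso; apply: (frontier_notin (frontier_X s)).
have -> : X s = (1 - 1 / 2) *: (X s + t *: normal s) +
    (1 / 2) *: (X s + t *: y).
  by rewrite yN; apply/rowP => i; rewrite !mxE; field.
apply: interior_subset; apply: scO.
- exact: subset_closure.
- exact: subset_closure.
- rewrite (inj_eq (addrI _)) (inj_eq (scalerI _)) ?gt_eqF // yN -addr_eq0.
  rewrite -mulr2n -scaler_nat scaler_eq0 pnatr_eq0 /=.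
  apply: contraTneq isT => n0; have := dot_normal_normal s.
  by rewrite n0 dotE !mxE mul0r addr0 => /eqP; rewrite eq_sym oner_eq0.
by apply/andP; split; lra.
Unshelve. all: by end_near. Qed.

Lemma directionE s r : direction Omega Ups (to_circle s, r) = velocity s r.
Proof.
by rewrite /direction /= inward_normalE rotN_normal (scalerA r sg).
Qed.

Lemma tauE s r : `|r| < 1 -> 0 < tau Omega Ups (to_circle s, r) /\
  X (s + arc s r) = X s + tau Omega Ups (to_circle s, r) *: velocity s r.
Proof.
move=> r1; have [t t0 tE] := arc_velocity s r1.
suff -> : tau Omega Ups (to_circle s, r) = t by [].
rewrite /tau directionE /= XE -[RHS]inf1; congr inf.
apply/seteqP; split => u /=; last first.
  by move=> ->; rewrite -tE; split => //; exact: frontier_X.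
move=> [u0 uf].
apply: (frontier_ray_unique (velocity_neq0 s (ltW r1)) u0 t0 (frontier_X s) uf).
by rewrite -tE; exact: frontier_X.
Qed.

Lemma tau_enorm s r : `|r| < 1 ->
  tau Omega Ups (to_circle s, r) = enorm (X (s + arc s r) - X s).
Proof.
move=> r1; have [t0 ->] := tauE s r1.
rewrite addrAC subrr add0r /enorm dotZl dotZr velocity_unit ?ltW // mulr1.
by rewrite -expr2 sqrtr_sqr gtr0_norm.
Qed.

(** At grazing incidence the billiard map is the identity by convention, and
    the formula still holds: the arc is then a full turn or none at all. *)
Lemma billiardE s r : `|r| <= 1 ->
  billiard Omega Ups (to_circle s, r) =
  (to_circle (s + arc s r), out_sine s r).
Proof.
rewrite /billiard le_eqVlt => /orP[/eqP r1|r1] /=.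
  rewrite r1 ltxx out_sine_boundary //; congr (_, _).
  by apply/esym/to_circleDint/arc_int.
have [t0 tE] := tauE s r1.
have nE : next_point Omega Ups (to_circle s, r) = to_circle (s + arc s r).
  rewrite /next_point directionE /= XE -tE.
  case: xgetP => [q _ /= qE|none]; first by apply: Ups_inj; rewrite qE XE.
  by case: (none (to_circle (s + arc s r))); rewrite /= XE.
rewrite r1 nE inward_normalE directionE /out_sine clamp_id ?ltW //.
congr (_, _).
have sinE (v w : 'rV[R]_2) : sin_angle (Defs.reflect w v) w =
      sin_angle v w.
  by rewrite /Defs.reflect /sin_angle !mxE; ring.
rewrite sinE /sin_angle dotE !mxE /=; ring.
Qed.

(** * The dissipative billiard map *)

Section Dissipative.
Variable lam : R.
Hypothesis lam01 : 0 < lam < 1.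
Local Notation f := (dissipative_billiard Omega Ups lam).

Lemma dissipativeE s r : `|r| <= 1 ->
  f (to_circle s, r) = (to_circle (s + arc s r), lam * out_sine s r).
Proof. by move=> r1; rewrite /dissipative_billiard billiardE. Qed.

Lemma dissipative_le p : annulus p -> `|(f p).2| <= lam.
Proof.
case: p => s r r1; rewrite -(lift_circleK s).
have [lam0 _] := andP lam01.
rewrite dissipativeE //= normrM gtr0_norm // ger_pMr //.
exact: out_sine_le1.
Qed.

Lemma dissipative_inj p q : annulus p -> annulus q -> f p = f q -> p = q.
Proof.
case: p q => [s r] [t u] r1 u1; rewrite -(lift_circleK s) -(lift_circleK t).
rewrite !dissipativeE // => -[/to_circleP sE oE].
have [lam0 _] := andP lam01.
have {}oE := mulfI (lt0r_neq0 lam0) oE.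
have [st /= ->] := step_injective r1 u1 sE oE.
by congr (_, _); apply/to_circleP.
Qed.

Lemma dissipative_cont : {within @annulus R, continuous f}.
Proof.
pose g (p : circle R * R) := f (p.1, clamp p.2).
have cg : continuous g.
  apply: continuous_cylinder.
  have -> : (fun p : R * R => g (to_circle p.1, p.2)) = (fun p : R * R =>
      (to_circle (p.1 + arc p.1 p.2), lam * out_sine p.1 p.2)).
    apply/funext => -[s r]; rewrite /g /= dissipativeE ?clamp_le1 //.
    by rewrite /out_sine /arc (clamp_id (clamp_le1 r)).
  have [c1 c2] := step_continuous.
  move=> p; apply: (@cvg_pair _ _ _ (nbhs p)
    (nbhs (to_circle (p.1 + arc p.1 p.2))) (nbhs (lam * out_sine p.1 p.2))).
    apply: (@continuous_comp _ _ _ (fun p : R * R => p.1 + arc p.1 p.2)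
      (@to_circle R)).
      exact: c1.
    exact: to_circle_continuous.
  by apply: cvgM; [exact: cvg_cst|exact: c2].
apply: (@subspace_eq_continuous _ _ _ g); last exact: continuous_subspaceT.
by move=> [s r] /set_mem; rewrite /annulus /g /= => r1; rewrite clamp_id.
Qed.

Lemma dissipative_boundary s e : `|e| = 1 -> f (s, e) = (s, lam * e).
Proof. by rewrite /dissipative_billiard /billiard /= => ->; rewrite ltxx. Qed.

(** If the Birkhoff attractor is a graph, the dynamics on it is conjugate to a
    circle homeomorphism, and [s + arc s (eta s)] is its lift. A continuous
    injective function of degree one is increasing. *)
Lemma graph_lift_increasing (eta : circle R -> R) :
  birkhoff_attractor Omega Ups lam = [set p | p.2 = eta p.1] ->
  (forall s, `|eta s| <= lam) /\
  {homo (fun s => s + arc s (eta (to_circle s))) : x y / x < y}.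
Proof.
move=> LE; have [lam0 lam1] := andP lam01.
have [eta_le eta_inv] := birkhoff_graph_invariant lam01
  dissipative_le dissipative_inj dissipative_cont
  dissipative_boundary LE.
split => //.
pose e (s : R) := eta (to_circle s).
have e1 s : `|e s| <= 1 by rewrite (le_trans (eta_le _)) // ltW.
have eper s : e (s + 1) = e s by rewrite /e to_circleDint // rpred1.
have ce : continuous e.
  apply: (@closed_graph_continuous _ _ _ (- lam) lam).
    by move=> s; rewrite -ler_norml; exact: eta_le.
  have -> : [set p : R * R | p.2 = e p.1] =
      (fun p : R * R => (to_circle p.1, p.2)) @^-1`
        birkhoff_attractor Omega Ups lam by rewrite LE.
  apply: preimage_closed; last by apply: closedI; exact: closed_closure.
  move=> p _; apply: (@cvg_pair _ _ _ (nbhs p) (nbhs (to_circle p.1))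
    (nbhs p.2)); last exact: cvg_snd.
  apply: (@continuous_comp _ _ _ (fun p : R * R => p.1) (@to_circle R)).
    exact: cvg_fst.
  exact: to_circle_continuous.
pose H s := s + arc s (e s); rewrite -/H.
have cH : continuous H.
  move=> s; apply: (@continuous_comp _ _ _ (fun s : R => (s, e s))
    (fun p : R * R => p.1 + arc p.1 p.2)); last exact: step_continuous.1.
  apply: (@cvg_pair _ _ _ (nbhs s) (nbhs s) (nbhs (e s))); last exact: ce.
  exact: cvg_id.
have Hinj : injective H.
  move=> s t st.
  have Es := eta_inv (to_circle s); have Et := eta_inv (to_circle t).
  rewrite -/(e s) -/(e t) !dissipativeE //= -/(H s) -/(H t) st in Es Et.
  have oE : out_sine s (e s) = out_sine t (e t).
    by apply: (mulfI (lt0r_neq0 lam0)); rewrite Es Et.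
  have stint : H s - H t \is a Num.int by rewrite st subrr rpred0.
  have [zi eE] := step_injective (e1 s) (e1 t) stint oE.
  move: st; rewrite /H eE -{2}[s](subrKC t) (arc_per t (e t) zi).
  exact: addIr.
have H1 s : H (s + 1) = H s + 1.
  by rewrite /H eper arc_per ?rpred1 // addrAC.
have [inc|dec] := @itv_continuous_inj_mono R H `]-oo, +oo[%R
    (continuous_subspaceT cH) (in2W Hinj).
  by move=> x y xy; apply: inc.
have : H (0 + 1) < H 0 by apply: dec; rewrite ?in_itv //= add0r ltr01.
by rewrite H1 gtrDl ltr10.
Qed.

End Dissipative.

(** For small [lambda] the values at [a] and [b] of the lift of the dynamics on
    a graph are close to [a + arc a 0] and [b + arc b 0], which are in the wrong
    order. *)
Lemma birkhoff_not_graph a (K : 'rV[R]_2) :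
  (forall i, is_derive a (1 : R) (fun t : R => T t 0 i) (K 0 i)) ->
  tau Omega Ups (to_circle a, 0) * enorm K < 1 ->
  exists2 lambda0 : R, 0 < lambda0 &
    forall lambda : R, 0 < lambda < 1 -> lambda < lambda0 ->
      ~ is_graph (birkhoff_attractor Omega Ups lambda).
Proof.
move=> dK; rewrite tau_enorm ?normr0 // => /(retrograde dK)[b ab bG].
(* Half the gap, so that errors below [d] at both points preserve the order. *)
pose d := (a + arc a 0 - (b + arc b 0)) / 2.
have d0 : 0 < d by rewrite divr_gt0 // subr_gt0.
have near_arc s : exists2 e, 0 < e &
    forall r, `|r| < e -> `|arc s 0 - arc s r| < d.
  have /cvgrPdist_lt /(_ _ d0) : (fun r => arc s r) @ (0 : R) --> arc s 0.
    apply: (@continuous_comp _ _ _ (fun r : R => (s, r))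
      (fun p : R * R => arc p.1 p.2)); last exact: arc_continuous.
    by apply: (@cvg_pair _ _ _ (nbhs (0 : R)) (nbhs s) (nbhs (0 : R)));
      [exact: cvg_cst|exact: cvg_id].
  move=> [e /= e0 eP]; exists e => // r re; apply: eP.
  by rewrite /ball_ /= sub0r normrN.
have [ea ea0 eaP] := near_arc a; have [eb eb0 ebP] := near_arc b.
exists (Num.min ea eb); first by rewrite lt_min ea0.
move=> lam lam01; rewrite lt_min => /andP[lea leb] [eta LE].
have [eta_le inc] := graph_lift_increasing lam01 LE.
have := inc _ _ ab.
have := eaP _ (le_lt_trans (eta_le (to_circle a)) lea).
have := ebP _ (le_lt_trans (eta_le (to_circle b)) leb).
rewrite /d !ltr_norml => /andP[? ?] /andP[? ?]; lra.
Qed.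

End Billiard.
End Oriented.
End Table.

(** * The theorem *)

Theorem proposition5p16 (R : realType) (k : nat) (Omega : set 'rV[R]_2)
    (Ups : circle R -> 'rV[R]_2) :
  (2 <= k)%N ->
  strongly_convex_domain k Omega Ups ->
  ~ class_D k Omega Ups ->
  (exists s0 : circle R, tau Omega Ups (s0, 0) * curvature Ups s0 > -1) ->
  exists2 lambda0 : R, 0 < lambda0 &
    forall lambda : R, 0 < lambda < 1 -> lambda < lambda0 ->
      ~ is_graph (birkhoff_attractor Omega Ups lambda).
Proof.
move=> k2 [[oO scO [dk _] uU [Uinj UO]] _] _ [s0 tk].
pose X : R -> 'rV[R]_2 := Ups \o @to_circle R.
pose T : R -> 'rV[R]_2 := X^`().
have dX (s : R) : is_derive s (1 : R) X (T s).
  rewrite /T derive1E; apply: derivableP.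
  by have := dk 0%N s (ltnW k2); rewrite derive1n0.
have dT (s : R) : derivable T s 1.
  by have := dk 1%N s k2; rewrite derive1n1.
have dTi i (s : R) : derivable (fun t => T t 0 i) s 1.
  by move/derivable_mxP : (dT s); apply.
have cT i : continuous (fun s => T s 0 i).
  by move=> s; apply/differentiable_continuous/derivable1_diffP.
have Xeq s t : X s = X t <-> s - t \is a Num.int.
  by split => [/Uinj /to_circleP //|/to_circleP st]; rewrite /X /= st.
have XO : range X = frontier Omega.
  rewrite -UO; apply/seteqP; split => [_ [s _ <-]|_ [p _ <-]].
    by exists (to_circle s).
  by exists (lift_circle p) => //; rewrite /X /= lift_circleK.
have TE s : circle_derive 1 Ups (to_circle s) = T s.
  rewrite /circle_derive derive1n1 -/X -/T -[lift_circle _](subrKC s).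
  exact: (T_per dX Xeq _ (lift_to_circle s)).
have uT s : dot (T s) (T s) = 1 by apply/enorm1P; rewrite -TE uU.
have [sg [sg2 sg_pos]] := orientation oO scO dX cT uT Xeq XO.
pose a := lift_circle s0.
pose K : 'rV[R]_2 := circle_derive 2 Ups s0.
have dK i : is_derive a (1 : R) (fun t : R => T t 0 i) (K 0 i).
  rewrite /K /circle_derive derive1nS derive1n1.
  apply: DeriveDef; first exact: dTi.
  by rewrite -/X -/T derive1E derive_mx // mxE.
apply: (birkhoff_not_graph oO scO dX cT uT Xeq XO sg2 sg_pos _ TE dK) => //.
by move: tk; rewrite /curvature /a lift_circleK -/K mulrN ltrN2.
Qed.
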